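(* Let $\nu>0$, $\Delta t>0$ and $n\ge 1$, and let $(\tilde{\mathbf u}^{n+1},\phi^{n+1},p^{n+1},\mathbf u^{n+1},R^{n+1})$ be computed from the data of the time steps $n$ and $n-1$ by the scheme (V), ($\Phi$), (P), (R) described in the context. Suppose that the external force vanishes ($\mathbf f=0$) and that the boundary condition is homogeneous ($\mathbf w=0$). Then $$ \left|\tfrac32 R^{n+1}-\tfrac12 R^{n}\right|^2-\left|\tfrac32 R^{n}-\tfrac12 R^{n-1}\right|^2 =-\frac{\left(R^{n+3/2}\right)^2}{E[\bar{\mathbf u}^{n+3/2}]}\,\nu\,\Delta t\int_{\Omega}\|\nabla\bar{\mathbf u}^{n+1}\|^2\,d\Omega\;\leqslant\;0 . $$
   Context: Setting. $\Omega\subset\mathbb R^d$ ($d=2,3$) is a bounded domain with boundary $\partial\Omega$ and outward unit normal $\mathbf n$. The problem is the incompressible Navier-Stokes system $\partial_t\mathbf u+\mathbf N(\mathbf u)+\nabla p-\nu\nabla^2\mathbf u=\mathbf f$, $\nabla\cdot\mathbf u=0$ in $\Omega$, with $\mathbf N(\mathbf u)=\mathbf u\cdot\nabla\mathbf u$ and $\mathbf u|_{\partial\Omega}=\mathbf w(\mathbf x,t)$. All fields are assumed regular enough that every expression below makes sense. A superscript $k$ denotes a quantity at time step $k$, with time step size $\Delta t$. Write $\|\nabla\mathbf v\|^2=\sum_{i,j}\partial_i v_j\,\partial_i v_j$. Energy. $E[\mathbf v]=\int_\Omega\frac12|\mathbf v|^2\,d\Omega+C_0$, where $C_0$ is a constant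 chosen so that the values of $E$ that occur are positive; in particular $E[\bar{\mathbf u}^{n+3/2}]>0$. The linear operator $\mathbf M$. $\mathbf M(\mathbf v)=\mathbf u_0\cdot\nabla\mathbf v+\frac12(\nabla\cdot\mathbf u_0)\mathbf v$, where $\mathbf u_0$ is a given velocity field: for a user-chosen integer $k_0\ge1$, at time step $n$ one takes $\mathbf u_0=\mathbf u^{mk_0}$ with $m$ the integer satisfying $mk_0\le n<(m+1)k_0$. Data. The fields $\mathbf u^n,\mathbf u^{n-1},\tilde{\mathbf u}^n,\tilde{\mathbf u}^{n-1},p^n$ (here $\mathbf u^k$ and $\tilde{\mathbf u}^k$ are two approximations of the velocity at step $k$) and the real scalars $R^n,R^{n-1}$ are given. Notation. $\tilde{\mathbf u}^{*,n+1}=2\tilde{\mathbf u}^n-\tilde{\mathbf u}^{n-1}$; $R^{n+3/2}=\frac32R^{n+1}-\frac12R^n$; $R^{n+1/2}=\frac32R^n-\frac12R^{n-1}$; $P^{n+1}=p^{n+1}+\nu\phi^{n+1}$; $\bar P^{n+1}=\bar p^{n+1}+\nu\bar\phi^{n+1}$. Scheme. The unknowns $\tilde{\mathbf u}^{n+1}$, $\phi^{n+1}$, $p^{n+1}$, $\mathbf u^{n+1}$ (fields) and $R^{n+1}$ (a real scalar) satisfy the following coupled system. (V) In $\Omega$, $$\frac{\frac32\tilde{\mathbf u}^{n+1}-2\mathbf u^n+\frac12\mathbf u^{n-1}}{\Delta t}+\mathbf M(\tilde{\mathbf u}^{n+1})+\nabla p^n-\nu\nabla^2\tilde{\mathbf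 u}^{n+1}+\xi\left[\mathbf N(\tilde{\mathbf u}^{*,n+1})-\mathbf M(\tilde{\mathbf u}^{*,n+1})\right]=\mathbf f^{n+1},$$ with $\xi=\dfrac{(R^{n+3/2})^2}{E[\bar{\mathbf u}^{n+3/2}]}$, and $\tilde{\mathbf u}^{n+1}=\mathbf w^{n+1}$ on $\partial\Omega$. ($\Phi$) $\phi^{n+1}=\nabla\cdot\tilde{\mathbf u}^{n+1}$, meaning that $\phi^{n+1}$ is the projection of $\nabla\cdot\tilde{\mathbf u}^{n+1}$ into $H^1(\Omega)$: $\int_\Omega\phi^{n+1}\varphi\,d\Omega=\int_\Omega(\nabla\cdot\tilde{\mathbf u}^{n+1})\varphi\,d\Omega$ for all $\varphi\in H^1(\Omega)$. (P) $\dfrac{\frac32\mathbf u^{n+1}-\frac32\tilde{\mathbf u}^{n+1}}{\Delta t}+\nabla\left(p^{n+1}-p^n+\nu\phi^{n+1}\right)=0$ and $\nabla\cdot\mathbf u^{n+1}=0$ in $\Omega$; $\mathbf n\cdot\mathbf u^{n+1}=\mathbf n\cdot\mathbf w^{n+1}$ on $\partial\Omega$; $\int_\Omega p^{n+1}\,d\Omega=0$. (R) $$\begin{aligned} &\left(\tfrac32R^{n+1}+R^n-\tfrac12R^{n-1}\right)\frac{\frac32R^{n+1}-2R^n+\frac12R^{n-1}}{\Delta t} =\int_\Omega\tilde{\mathbf u}^{n+1}\cdot\frac{\frac32\mathbf u^{n+1}-2\mathbf u^n+\frac12\mathbf u^{n-1}}{\Delta t}\,d\Omega\\ &\quad+\xi\left[-\nu\int_\Omega\|\nabla\bar{\mathbf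 u}^{n+1}\|^2d\Omega+A_1+A_2\right]\\ &\quad-\int_\Omega\left[-\mathbf M(\tilde{\mathbf u}^{n+1})-\nabla P^{n+1}+\nu\nabla^2\tilde{\mathbf u}^{n+1}-\xi\left(\mathbf N(\tilde{\mathbf u}^{*,n+1})-\mathbf M(\tilde{\mathbf u}^{*,n+1})\right)+\mathbf f^{n+1}\right]\cdot\tilde{\mathbf u}^{n+1}d\Omega\\ &\quad+(1-\xi)\left(|A_1|+|A_2|\right), \end{aligned}$$ where $A_1=\int_\Omega\mathbf f^{n+1}\cdot\bar{\mathbf u}^{n+1}d\Omega$ and $A_2=\int_{\partial\Omega}\left(-\bar P^{n+1}\mathbf n+\nu\,\mathbf n\cdot\nabla\bar{\mathbf u}^{n+1}-\frac12(\mathbf n\cdot\mathbf w^{n+1})\mathbf w^{n+1}\right)\cdot\mathbf w^{n+1}dA$. Barred quantities. Let $\tilde{\mathbf u}_1^{n+1}$ and $\tilde{\mathbf u}_2^{n+1}$ solve $$\tfrac{3}{2\Delta t}\tilde{\mathbf u}_1^{n+1}+\mathbf M(\tilde{\mathbf u}_1^{n+1})-\nu\nabla^2\tilde{\mathbf u}_1^{n+1}=\mathbf f^{n+1}+\tfrac{1}{\Delta t}\left(2\mathbf u^n-\tfrac12\mathbf u^{n-1}\right)-\nabla p^n\ \text{in }\Omega,\qquad \tilde{\mathbf u}_1^{n+1}=\mathbf w^{n+1}\ \text{on }\partial\Omega,$$ $$\tfrac{3}{2\Delta t}\tilde{\mathbf u}_2^{n+1}+\mathbf M(\tilde{\mathbf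 u}_2^{n+1})-\nu\nabla^2\tilde{\mathbf u}_2^{n+1}=-\left[\mathbf N(\tilde{\mathbf u}^{*,n+1})-\mathbf M(\tilde{\mathbf u}^{*,n+1})\right]\ \text{in }\Omega,\qquad \tilde{\mathbf u}_2^{n+1}=0\ \text{on }\partial\Omega.$$ Then $\bar{\mathbf u}^{n+1}=\tilde{\mathbf u}_1^{n+1}+\tilde{\mathbf u}_2^{n+1}$ and $\bar{\mathbf u}^{n+3/2}=\frac32\bar{\mathbf u}^{n+1}-\frac12\tilde{\mathbf u}^n$. For $i=1,2$ let $\phi_i^{n+1}$ be the projection of $\nabla\cdot\tilde{\mathbf u}_i^{n+1}$ into $H^1(\Omega)$ (in the sense of ($\Phi$)), and let $p_1^{n+1},p_2^{n+1}\in H^1(\Omega)$ have zero mean over $\Omega$ and satisfy, for all $q\in H^1(\Omega)$, $$\int_\Omega\nabla p_1^{n+1}\cdot\nabla q\,d\Omega=\int_\Omega\left(\tfrac{3}{2\Delta t}\tilde{\mathbf u}_1^{n+1}+\nabla p^n-\nu\nabla\phi_1^{n+1}\right)\cdot\nabla q\,d\Omega-\tfrac{3}{2\Delta t}\int_{\partial\Omega}\mathbf n\cdot\mathbf w^{n+1}q\,dA,$$ $$\int_\Omega\nabla p_2^{n+1}\cdot\nabla q\,d\Omega=\int_\Omega\left(\tfrac{3}{2\Delta t}\tilde{\mathbf u}_2^{n+1}-\nu\nabla\phi_2^{n+1}\right)\cdot\nabla q\,d\Omega.$$ Then $\bar\phi^{n+1}=\phi_1^{n+1}+\phi_2^{n+1}$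 and $\bar p^{n+1}=p_1^{n+1}+p_2^{n+1}$. *)

(* Defs.v *)
From HB Require Import structures.
From mathcomp Require Import all_boot all_order all_algebra.
From mathcomp Require Import all_classical all_reals all_analysis.
From mathcomp Require Import measurable_realfun ring lra.

Set Implicit Arguments.
Unset Strict Implicit.
Unset Printing Implicit Defensive.

Import Order.TTheory GRing.Theory Num.Theory.
Import numFieldNormedType.Exports.

Local Open Scope classical_set_scope.
Local Open Scope ring_scope.

Section euclidean.
Context {R : realType} {d : nat}.
Implicit Types x y : 'rV[R]_d.

Definition dotv x y : R := \sum_i x 0 i * y 0 i.

(* The library norm of 'rV[R]_d is the sup norm. *)
Definition enorm x : R := Num.sqrt (dotv x x).

Definition ediam (A : set 'rV[R]_d) : \bar R :=
  ereal_sup [set (enorm (xy.1 - xy.2))%:E | xy in A `*` A].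

End euclidean.

Section covering_measure.
Context {R : realType} {T : pointedType}.
Variable w : set T -> \bar R.

(* The absolute value only makes the construction total: both weights used
   below are nonnegative. *)
Definition cover_weight (A : set T) : \bar R :=
  if A == set0 then 0%E else `|w A|%E.

(* Every subset is measurable in the carrier used here, so that mu_ext takes
   the infimum over countable covers by arbitrary sets. *)
Definition cover_measure : set T -> \bar R :=
  mu_ext (cover_weight : set (g_sigma_algebraType [set: set T]) -> \bar R).

Lemma cover_weight0 : cover_weight set0 = 0%E.
Proof. by rewrite /cover_weight eqxx. Qed.

Lemma cover_weight_ge0 (A : set (g_sigma_algebraType [set: set T])) :
  (0 <= cover_weight A)%E.
Proof. by rewrite /cover_weight; case: ifP => // _; exact: abse_ge0. Qed.

Lemma cover_measure0 : cover_measure set0 = 0%E.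
Proof. exact: (mu_ext0 cover_weight0 cover_weight_ge0). Qed.

Lemma cover_measure_ge0 A : (0 <= cover_measure A)%E.
Proof. exact: (mu_ext_ge0 cover_weight_ge0). Qed.

Lemma le_cover_measure : {homo cover_measure : A B / A `<=` B >-> (A <= B)%E}.
Proof. exact: (@le_mu_ext _ (g_sigma_algebraType [set: set T]) R cover_weight). Qed.

Lemma cover_measure_sigma_subadditive : sigma_subadditive cover_measure.
Proof. exact: (mu_ext_sigma_subadditive cover_weight_ge0). Qed.

HB.instance Definition _ := isOuterMeasure.Build R T cover_measure
  cover_measure0 cover_measure_ge0 le_cover_measure
  cover_measure_sigma_subadditive.

Lemma cover_measure_le (A : set T) (F : (set T)^nat) :
  A `<=` \bigcup_k F k -> (cover_measure A <= \sum_(k <oo) cover_weight (F k))%E.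
Proof.
move=> AF; apply: ereal_inf_lbound; exists F => //; split=> // i.
by apply: sub_sigma_algebra.
Qed.

Lemma cover_measure_adherent (A : set T) (e : R) : 0 < e ->
  cover_measure A \is a fin_num ->
  exists2 F : (set T)^nat, A `<=` \bigcup_k F k &
    (\sum_(k <oo) cover_weight (F k) < cover_measure A + e%:E)%E.
Proof.
move=> e0 Afin; have [x [F [_ AF] <-] xe] := lb_ereal_inf_adherent e0 Afin.
by exists F.
Qed.

End covering_measure.

Section lebesgue.
Context {R : realType} (d : nat).

Definition box_volume (A : set 'rV[R]_d) : \bar R :=
  ereal_inf [set (\prod_i (ab.2 0 i - ab.1 0 i))%:E | ab in
    [set ab : 'rV[R]_d * 'rV[R]_d | (forall i, ab.1 0 i <= ab.2 0 i) /\
      A `<=` [set x | forall i, ab.1 0 i <= x 0 i <= ab.2 0 i]]].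

Definition lebesgue_outer : {outer_measure set 'rV[R]_d -> \bar R} :=
  @cover_measure R 'rV[R]_d box_volume.

(* The measurable sets are the Caratheodory measurable ones, i.e. the Lebesgue
   measurable subsets of R^d. *)
Definition leb : {measure set (caratheodory_type lebesgue_outer) -> \bar R} :=
  lebesgue_outer.

End lebesgue.

Section open_lebesgue.
Context {R : realType} (d : nat).

Lemma box_volume_ge0 (A : set 'rV[R]_d) : (0 <= box_volume A)%E.
Proof.
apply: le_ereal_inf_tmp => _ [[a b] /= [ab _] <-].
by rewrite lee_fin prodr_ge0// => i _; rewrite subr_ge0.
Qed.

Lemma cover_weight_le_box (A : set 'rV[R]_d) :
  (cover_weight (@box_volume R d) A <= box_volume A)%E.
Proof.
rewrite /cover_weight; case: ifP => _; first exact: box_volume_ge0.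
by rewrite gee0_abs// box_volume_ge0.
Qed.

Lemma box_volume_split (A : set 'rV[R]_d) (i : 'I_d) (c : R) :
  (cover_weight (@box_volume R d) (A `&` [set x | (x 0 i <= c)%R]) +
   cover_weight (@box_volume R d) (A `&` ~` [set x | (x 0 i <= c)%R]) <=
   cover_weight (@box_volume R d) A)%E.
Proof.
have [->|/eqP A0] := pselect (A = set0).
  by rewrite !set0I !cover_weight0 adde0.
rewrite [leRHS]/cover_weight (negbTE A0) gee0_abs ?box_volume_ge0//.
apply: (le_trans (leeD (cover_weight_le_box _) (cover_weight_le_box _))).
apply: le_ereal_inf_tmp => _ [[a b] /= [ab Aab] <-].
pose m := Num.max (a 0 i) (Num.min (b 0 i) c).
have am : a 0 i <= m by rewrite /m le_max lexx.
have mb : m <= b 0 i by rewrite /m ge_max ab ge_min lexx.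
pose b' : 'rV[R]_d := \row_j (if j == i then m else b 0 j).
pose a' : 'rV[R]_d := \row_j (if j == i then m else a 0 j).
rewrite [leRHS](_ : _ = (\prod_j (b' 0 j - a 0 j))%:E +
                        (\prod_j (b 0 j - a' 0 j))%:E)%E; last first.
  rewrite -EFinD; congr EFin.
  rewrite (bigD1 i)//= [X in _ = X + _](bigD1 i)//= [X in _ = _ + X](bigD1 i)//=.
  rewrite !mxE eqxx.
  under [X in _ = _ * X + _]eq_bigr => j /negbTE ji do rewrite mxE ji.
  under [X in _ = _ + _ * X]eq_bigr => j /negbTE ji do rewrite mxE ji.
  by rewrite -mulrDl [m - _ + _]addrC subrKA.
apply: leeD; apply: ereal_inf_lbound.
- exists (a, b') => //=; split=> [j|x [Ax xc] j].
    by rewrite mxE; case: eqP => [->|].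
  have /andP[ax xb] := Aab _ Ax j.
  rewrite ax mxE /=; case: eqP => [ji|//]; subst j.
  by rewrite /m le_max le_min xb xc orbT.
- exists (a', b) => //=; split=> [j|x [Ax /negP]].
    by rewrite mxE; case: eqP => [->|].
  rewrite -ltNge => cx j.
  have /andP[ax xb] := Aab _ Ax j.
  rewrite xb mxE andbT; case: eqP => [ji|//]; subst j.
  by rewrite /m ge_max ax ge_min (ltW cx) orbT.
Qed.

Lemma halfspace_lebesgue (i : 'I_d) (c : R) :
  (@lebesgue_outer R d).-caratheodory [set x | x 0 i <= c].
Proof.
apply: le_caratheodory_measurable => X.
have [Xoo|Xoo] := eqVneq (lebesgue_outer d X) +oo%E; first by rewrite Xoo leey.
have Xfin : lebesgue_outer d X \is a fin_num.
  by rewrite ge0_fin_numE ?lt_neqAle ?Xoo ?leey// outer_measure_ge0.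
apply/lee_addgt0Pr => e e0.
have [F XF /ltW Fe] := cover_measure_adherent e0 Xfin.
apply: le_trans Fe; pose H : set 'rV[R]_d := [set x | x 0 i <= c].
have wge0 A := @cover_weight_ge0 R 'rV[R]_d (@box_volume R d) A.
apply: (@le_trans _ _ (\sum_(k <oo) cover_weight (@box_volume R d) (F k `&` H) +
   \sum_(k <oo) cover_weight (@box_volume R d) (F k `&` ~` H))%E).
  by apply: leeD; apply: cover_measure_le; rewrite -setI_bigcupl;
    apply: setSI.
rewrite -nneseriesD//.
by apply: lee_nneseries => k *; [rewrite adde_ge0 ?wge0|exact: box_volume_split].
Qed.

Lemma measurable_coord_leb (i : 'I_d) :
  measurable_fun [set: caratheodory_type (@lebesgue_outer R d)]
    ((fun x => x 0 i) : caratheodory_type (@lebesgue_outer R d) -> R).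
Proof.
apply: (measurability _ (RGenOInfty.measurableE R)).
move=> _ [_ [c ->] <-]; rewrite setTI.
rewrite (_ : _ @^-1` _ = ~` [set x : 'rV[R]_d | x 0 i <= c]).
  exact/caratheodory_measurable_setC/halfspace_lebesgue.
by apply/seteqP; split=> x /=; rewrite in_itv/= andbT ltNge => /negP.
Qed.

Lemma ball_lebesgue (y : 'rV[R]_d) (e : R) : 0 < e ->
  measurable (ball y e : set (caratheodory_type (@lebesgue_outer R d))).
Proof.
move=> e0; rewrite (_ : ball y e = \bigcap_(i in [set: 'I_d])
    [set x : 'rV[R]_d | ball (y 0 i) e (x 0 i)]).
  apply: (@fin_bigcap_measurable _ (caratheodory_type (@lebesgue_outer R d)))
    => // i _.
  rewrite -[X in measurable X]setTI; apply: measurable_coord_leb => //.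
  exact: measurable_ball.
apply/seteqP; split=> x.
  by case=> _ yx i _; exact: yx.
by move=> yx; split=> // i j; rewrite !ord1; exact: yx.
Qed.

Lemma open_lebesgue (A : set 'rV[R]_d) : open A ->
  measurable (A : set (caratheodory_type (@lebesgue_outer R d))).
Proof.
move=> oA.
pose B (n : nat) : set 'rV[R]_d :=
  if unpickle n is Some qk then
    let b := ball (map_mx ratr (qk : 'rV[rat]_d * nat).1 : 'rV[R]_d) qk.2.+1%:R^-1 in
    if `[< b `<=` A >] then b else set0
  else set0.
rewrite (_ : A = \bigcup_n B n).
  apply: (@bigcupT_measurable _ (caratheodory_type (@lebesgue_outer R d))) => n.
  rewrite /B; case: (unpickle n) => [qk|]; last exact: measurable0.
  by case: ifPn => _; [exact: ball_lebesgue|exact: measurable0].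
apply/seteqP; split=> x; last first.
  case=> n _; rewrite /B; case: (unpickle n) => [qk|//].
  by case: ifPn => [/asboolP bA /bA|].
move=> Ax.
have /nbhs_ballP[e /= e0 eA] : nbhs x A by exact: open_nbhs_nbhs.
have [k ke] : exists k : nat, k.+1%:R^-1 < e / 2.
  have e20 : 0 < e / 2 by rewrite divr_gt0.
  have [k _ ke] := near_infty_natSinv_lt (PosNum e20).
  by exists k; apply: ke => /=.
have k0 : 0 < k.+1%:R^-1 :> R by [].
have /choice[q qx] (i : 'I_d) : exists q : rat,
    ball (x 0 i) k.+1%:R^-1 (ratr q : R).
  have b0 : ball (x 0 i) k.+1%:R^-1 !=set0 by exists (x 0 i); exact: ballxx.
  have ob : open (ball (x 0 i) (k.+1%:R^-1 : R)) by exact: ball_open.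
  have [r [xr [q _ qE]]] := @dense_rat R _ b0 ob.
  by exists q; rewrite qE.
have xb : ball (map_mx ratr (\row_i q i : 'rV[rat]_d) : 'rV[R]_d) k.+1%:R^-1 x.
  by split=> // i j; rewrite !ord1 !mxE; exact/ball_sym/qx.
exists (pickle (\row_i q i : 'rV[rat]_d, k)) => //.
rewrite /B pickleK/= ifT//; apply/asboolP => z qz; apply: eA.
apply: (@le_ball _ _ x (k.+1%:R^-1 + k.+1%:R^-1)).
  by rewrite [leRHS]splitr lerD// ltW.
exact: ball_triangle (ball_sym xb) qz.
Qed.

End open_lebesgue.

Section hausdorff.
Context {R : realType} (d s : nat).

(* A set of diameter 2r has the weight of a ball of radius r of R^s; with this
   normalization the Hausdorff measure of dimension d - 1 is the surface
   area. *)
Definition hausdorff_weight (delta : R) (A : set 'rV[R]_d) : \bar R :=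
  if (ediam A <= delta%:E)%E then
    (fine (leb s [set x : 'rV[R]_s | enorm x <= 1]) *
       (fine (ediam A) / 2) ^+ s)%:E
  else +oo%E.

Definition hausdorff_fun (A : set 'rV[R]_d) : \bar R :=
  ereal_sup [set cover_measure (hausdorff_weight delta) A |
    delta in [set delta : R | 0 < delta]].

Lemma hausdorff0 : hausdorff_fun set0 = 0%E.
Proof.
rewrite /hausdorff_fun (_ : image _ _ = [set 0%E]) ?ereal_sup1//.
apply/seteqP; split=> [_ [e _ <-]|_ ->]; first exact: outer_measure0.
by exists 1 => //=; exact: outer_measure0.
Qed.

Lemma hausdorff_ge0 A : (0 <= hausdorff_fun A)%E.
Proof.
apply: (@le_trans _ _ (cover_measure (hausdorff_weight 1) A)).
  exact: outer_measure_ge0.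
by apply: ereal_sup_ubound; exists 1 => /=.
Qed.

Lemma le_hausdorff : {homo hausdorff_fun : A B / A `<=` B >-> (A <= B)%E}.
Proof.
move=> A B AB; apply: ge_ereal_sup => _ [e e0 <-].
apply: (@le_trans _ _ (cover_measure (hausdorff_weight e) B)).
  exact: le_outer_measure.
by apply: ereal_sup_ubound; exists e.
Qed.

Lemma hausdorff_sigma_subadditive : sigma_subadditive hausdorff_fun.
Proof.
move=> F; apply: ge_ereal_sup => _ [e e0 <-].
apply: (le_trans (outer_measure_sigma_subadditive _ _)).
apply: lee_nneseries => [k _ _|k _]; first exact: outer_measure_ge0.
by apply: ereal_sup_ubound; exists e.
Qed.

HB.instance Definition _ := isOuterMeasure.Build R 'rV[R]_d hausdorff_fun
  hausdorff0 hausdorff_ge0 le_hausdorff hausdorff_sigma_subadditive.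

Definition hausdorff_outer : {outer_measure set 'rV[R]_d -> \bar R} :=
  hausdorff_fun.

Definition hausdorff :
    {measure set (caratheodory_type hausdorff_outer) -> \bar R} :=
  hausdorff_outer.

End hausdorff.

Section square_integrable.
Context {disp} {T : measurableType disp} {R : realType}.
Variable mu : {measure set T -> \bar R}.

Definition square_integrable (D : set T) (f : T -> R) : Prop :=
  measurable_fun D f /\ mu.-integrable D (fun x => (f x ^+ 2)%:E).

Lemma square_integrable0 D : measurable D -> square_integrable D (cst 0).
Proof.
move=> mD; split=> //; apply: (eq_integrable mD (cst 0%E)).
  by move=> x _ /=; rewrite expr0n.
exact: integrable0.
Qed.

Lemma square_integrable_lin D (a : R) f g : measurable D ->
  square_integrable D f -> square_integrable D g ->
  square_integrable D (fun x => a * f x + g x).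
Proof.
move=> mD [mf If] [mg Ig].
have mafg : measurable_fun D (fun x => a * f x + g x).
  by apply: measurable_funD => //; apply: measurable_funM.
split=> //.
pose h x := ((2 * a ^+ 2)%:E * (f x ^+ 2)%:E + 2%:E * (g x ^+ 2)%:E)%E.
have Ih : mu.-integrable D h.
  by apply: integrableD => //; apply: integrableZl.
apply: (le_integrable mD _ _ Ih).
  by apply/measurable_EFinP; exact: (measurable_funX 2 mafg).
move=> x _; rewrite /h -!EFinM -EFinD !abse_EFin lee_fin.
rewrite !ger0_norm ?sqr_ge0//; last first.
  by rewrite -mulrA -exprMn -mulrDr mulr_ge0 ?addr_ge0 ?sqr_ge0.
rewrite -subr_ge0 (_ : _ - _ = (a * f x - g x) ^+ 2) ?sqr_ge0//.
by rewrite sqrrB sqrrD exprMn; lra.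
Qed.

End square_integrable.

Section domains.
Context {R : realType} {d : nat}.

Definition bdry (A : set 'rV[R]_d) : set 'rV[R]_d := closure A `\` interior A.

Record domain := Domain {
  dset :> set 'rV[R]_d ;
  dset_open : open dset ;
  dset_connected : connected dset ;
  dset_bounded : bounded_set dset ;
  dset_nonempty : dset !=set0 }.

(* nu is the outward unit normal of A at x: nearby, A is the half-space
   {y | (y - x) . nu < 0} up to an error o(|y - x|). *)
Definition outward_normal (A : set 'rV[R]_d) (x nu : 'rV[R]_d) : Prop :=
  enorm nu = 1 /\
  forall e : R, 0 < e -> \forall y \near x,
    (dotv (y - x) nu < - e * enorm (y - x) -> A y) /\
    (e * enorm (y - x) < dotv (y - x) nu -> ~ A y).

Definition volint (Om : domain) (g : 'rV[R]_d -> R) : R :=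
  Rintegral (leb d) Om g.

Definition surface_measure := @hausdorff R d d.-1.

Definition surfint (Om : domain) (g : 'rV[R]_d -> R) : R :=
  Rintegral surface_measure (bdry Om) g.

Definition L2 (Om : domain) (g : 'rV[R]_d -> R) : Prop :=
  square_integrable (leb d) Om g.

Definition ae_in (Om : domain) (P : 'rV[R]_d -> Prop) : Prop :=
  {ae leb d, forall x, dset Om x -> P x}.

Definition ae_bdry (Om : domain) (P : 'rV[R]_d -> Prop) : Prop :=
  {ae surface_measure, forall x, bdry Om x -> P x}.

Lemma measurable_domain (Om : domain) :
  measurable (Om : set (caratheodory_type (@lebesgue_outer R d))).
Proof. exact/open_lebesgue/dset_open. Qed.

End domains.
Arguments domain : clear implicits.

Section sobolev.
Context {R : realType} {d : nat}.
Implicit Types (f : 'rV[R]_d -> R) (i : 'I_d).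

Definition pderiv i f : 'rV[R]_d -> R := fun x => 'D_(delta_mx 0 i) f x.

Fixpoint continuously_diff (k : nat) f : Prop :=
  continuous f /\
  if k is k'.+1 then
    forall i, (forall x, derivable f x (delta_mx 0 i)) /\
      continuously_diff k' (pderiv i f)
  else True.

Definition smooth f := forall k, continuously_diff k f.

Definition test_function (Om : domain R d) f : Prop :=
  smooth f /\ exists K : set 'rV[R]_d,
    [/\ compact K, K `<=` Om & forall x, ~ K x -> f x = 0].

(* The integrability clauses are automatic for square integrable f and g. *)
Definition weak_pderiv (Om : domain R d) i f (g : 'rV[R]_d -> R) : Prop :=
  forall t, test_function Om t ->
    [/\ (leb d).-integrable Om (fun x => (f x * pderiv i t x)%:E),
        (leb d).-integrable Om (fun x => (g x * t x)%:E) &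
        volint Om (fun x => f x * pderiv i t x) =
          - volint Om (fun x => g x * t x)].

Definition sobolev_pair (Om : domain R d)
    (fg : ('rV[R]_d -> R^o) * ('I_d -> 'rV[R]_d -> R^o)) : Prop :=
  [/\ L2 Om fg.1, forall i, L2 Om (fg.2 i) &
      forall i, weak_pderiv Om i fg.1 (fg.2 i)].

Definition sobolev_pred Om :
    {pred ('rV[R]_d -> R^o) * ('I_d -> 'rV[R]_d -> R^o)} :=
  [pred fg | `[< sobolev_pair Om fg >]].

Lemma sobolev_submod Om : submod_closed (sobolev_pred Om).
Proof.
have mO := measurable_domain Om.
split.
  apply/asboolP; split=> [|i|i t _] /=; try exact: square_integrable0.
  have zint h : (leb d).-integrable Om (fun x => ((0 : R) * h x)%:E).
    apply: (eq_integrable mO (cst 0%E)); last exact: integrable0.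
    by move=> x _; rewrite mul0r.
  split; [exact: zint|exact: zint|].
  rewrite /volint -[RHS]mulN1r.
  under eq_Rintegral do rewrite mul0r.
  rewrite [X in _ = _ * X](_ : _ = 0); last first.
    under eq_Rintegral do rewrite mul0r.
    by rewrite /Rintegral integral0.
  by rewrite /Rintegral integral0 mulr0.
move=> a [f f'] [g g'] /asboolP[/= Lf Lf' wf] /asboolP[/= Lg Lg' wg].
apply/asboolP; split=> [|i|i t tt] /=.
- exact: (square_integrable_lin a mO Lf Lg).
- exact: (square_integrable_lin a mO (Lf' i) (Lg' i)).
have [f1 f2 f3] := wf i t tt; have [g1 g2 g3] := wg i t tt.
have lin (h k s : 'rV[R]_d -> R) :
    (leb d).-integrable Om (fun x => (h x * s x)%:E) ->
    (leb d).-integrable Om (fun x => (k x * s x)%:E) ->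
    (leb d).-integrable Om (fun x => ((a * h x + k x) * s x)%:E) /\
    volint Om (fun x => (a * h x + k x) * s x) =
      a * volint Om (fun x => h x * s x) + volint Om (fun x => k x * s x).
  move=> Ih Ik.
  have Iah : (leb d).-integrable Om (fun x => (a * (h x * s x))%:E).
    exact: (integrableZl mO a Ih).
  have E x : (a * h x + k x) * s x = a * (h x * s x) + k x * s x.
    by rewrite mulrDl mulrA.
  split.
    have := integrableD mO Iah Ik; apply: eq_integrable => // x _ /=.
    by rewrite E EFinD.
  rewrite /volint; under eq_Rintegral do rewrite E.
  by rewrite RintegralD// RintegralZl.
have [F1 F2] := lin _ _ _ f1 g1; have [G1 G2] := lin _ _ _ f2 g2.
split; [exact: F1|exact: G1|].
by rewrite [LHS]F2 [volint _ _ in RHS]G2 f3 g3 mulrN opprD.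
Qed.

HB.instance Definition _ Om := GRing.isSubmodClosed.Build R _ (sobolev_pred Om)
  (sobolev_submod Om).

(* H^1(Om): square integrable functions bundled with their weak first
   derivatives; it is a vector space over R. *)
Record H1 (Om : domain R d) := H1Pack {
  h1_pair : ('rV[R]_d -> R^o) * ('I_d -> 'rV[R]_d -> R^o) ;
  h1_pairP : h1_pair \in sobolev_pred Om }.

HB.instance Definition _ Om := [isSub for @h1_pair Om].
HB.instance Definition _ Om := [Choice of H1 Om by <:].
HB.instance Definition _ Om := [SubChoice_isSubLmodule of H1 Om by <:].

Definition h1_fun Om (q : H1 Om) : 'rV[R]_d -> R := (h1_pair q).1.
Definition wd Om i (q : H1 Om) : 'rV[R]_d -> R := (h1_pair q).2 i.

End sobolev.

Section sobolev2.
Context {R : realType} {d : nat}.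
Variable Om : domain R d.

Definition sobolev2_pred : {pred H1 Om * ('I_d -> H1 Om)} :=
  [pred qg | `[< forall i, h1_fun (qg.2 i) = wd i qg.1 >]].

Lemma sobolev2_submod : submod_closed sobolev2_pred.
Proof.
split; first exact/asboolP.
move=> a [q g] [s h] /asboolP/= qg /asboolP/= sh; apply/asboolP => i.
by rewrite -[LHS]/(a *: h1_fun (g i) + h1_fun (h i)) qg sh.
Qed.

HB.instance Definition _ := GRing.isSubmodClosed.Build R _ sobolev2_pred
  sobolev2_submod.

(* H^2(Om): elements of H^1(Om) bundled with their first derivatives, these
   being elements of H^1(Om) themselves. *)
Record H2 := H2Pack {
  h2_pair : H1 Om * ('I_d -> H1 Om) ;
  h2_pairP : h2_pair \in sobolev2_pred }.

HB.instance Definition _ := [isSub for h2_pair].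
HB.instance Definition _ := [Choice of H2 by <:].
HB.instance Definition _ := [SubChoice_isSubLmodule of H2 by <:].

Definition h2_h1 (q : H2) : H1 Om := (h2_pair q).1.
Definition h2_pd (i : 'I_d) (q : H2) : H1 Om := (h2_pair q).2 i.

Definition is_trace (q : H1 Om) (g : 'rV[R]_d -> R) : Prop :=
  square_integrable surface_measure (bdry Om) g /\
  exists s : nat -> 'rV[R]_d -> R,
    [/\ forall k, smooth (s k),
        (fun k => \int[leb d]_(x in Om) ((s k x - h1_fun q x) ^+ 2)%:E)%E
          @ \oo --> 0%E,
        forall i,
          (fun k => \int[leb d]_(x in Om) ((pderiv i (s k) x - wd i q x) ^+ 2)%:E)%E
            @ \oo --> 0%E &
        (fun k => \int[surface_measure]_(x in bdry Om) ((s k x - g x) ^+ 2)%:E)%E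
          @ \oo --> 0%E].

(* The trace operator; on a Lipschitz domain every element of H^1(Om) has a
   trace, unique up to equality almost everywhere on the boundary. *)
Definition tr (q : H1 Om) : 'rV[R]_d -> R := xget (cst 0) [set g | is_trace q g].

End sobolev2.

Section fields.
Context {R : realType} {d : nat} {Om : domain R d}.
Implicit Types (q : H1 Om) (a v : 'I_d -> H1 Om) (z : 'I_d -> H2 Om).

Definition h1_vec z : 'I_d -> H1 Om := fun j => h2_h1 (z j).

Definition vval v (x : 'rV[R]_d) : 'rV[R]_d := \row_j h1_fun (v j) x.

Definition grad q (x : 'rV[R]_d) : 'rV[R]_d := \row_i wd i q x.

Definition divergence v (x : 'rV[R]_d) : R := \sum_i wd i (v i) x.

Definition laplacian z (x : 'rV[R]_d) : 'rV[R]_d :=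
  \row_j \sum_i wd i (h2_pd i (z j)) x.

(* (a . nabla) v *)
Definition advection a v (x : 'rV[R]_d) : 'rV[R]_d :=
  \row_j \sum_i h1_fun (a i) x * wd i (v j) x.

Definition grad_sqnorm v (x : 'rV[R]_d) : R :=
  \sum_i \sum_j wd i (v j) x * wd i (v j) x.

Definition Nop v : 'rV[R]_d -> 'rV[R]_d := advection v v.

Definition Mop u0 v (x : 'rV[R]_d) : 'rV[R]_d :=
  advection u0 v x + (2^-1 * divergence u0 x) *: vval v x.

Definition energy (C0 : R) v : R :=
  volint Om (fun x => 2^-1 * dotv (vval v x) (vval v x)) + C0.

Definition is_projection q (g : 'rV[R]_d -> R) : Prop :=
  forall s : H1 Om, volint Om (fun x => h1_fun q x * h1_fun s x) =
    volint Om (fun x => g x * h1_fun s x).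

Definition zero_mean q : Prop := volint Om (h1_fun q) = 0.

Definition boundary_value v (g : 'rV[R]_d -> 'rV[R]_d) : Prop :=
  forall j, is_trace (v j) (fun x => g x 0 j).

Definition normal_boundary_value (nv : 'rV[R]_d -> 'rV[R]_d) v
    (g : 'rV[R]_d -> 'rV[R]_d) : Prop :=
  exists2 h, boundary_value v h &
    ae_bdry Om (fun x => dotv (nv x) (h x) = dotv (nv x) (g x)).

(* n . nabla v on the boundary *)
Definition normal_derivative (nv : 'rV[R]_d -> 'rV[R]_d) z (x : 'rV[R]_d) :
    'rV[R]_d :=
  \row_j \sum_i nv x 0 i * tr (h2_pd i (z j)) x.

Definition unit_outward_normal (nv : 'rV[R]_d -> 'rV[R]_d) : Prop :=
  ae_bdry Om (fun x => outward_normal Om x (nv x)).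

End fields.
Arguments unit_outward_normal {R d} Om nv.

Section scheme.
Context {R : realType} {d : nat} (Om : domain R d).
Variables (nv : 'rV[R]_d -> 'rV[R]_d) (nu dt C0 : R).
(* Index k of a sequence is the time level k. *)
Variables (f w : nat -> 'rV[R]_d -> 'rV[R]_d).
Variables (u : nat -> 'I_d -> H1 Om) (ut : nat -> 'I_d -> H2 Om).
Variables (p phi : nat -> H1 Om) (r : nat -> R).
Variables (u0 : 'I_d -> H1 Om) (n : nat).
Variables (u1 u2 : 'I_d -> H2 Om) (phi1 phi2 p1 p2 : H1 Om).

Definition ustar : 'I_d -> H1 Om := 2 *: h1_vec (ut n) - h1_vec (ut n.-1).

Definition nonlinear_residual (x : 'rV[R]_d) : 'rV[R]_d :=
  Nop ustar x - Mop u0 ustar x.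

Record barred_solution : Prop := {
  barred_u1 : ae_in Om (fun x =>
    (3 / (2 * dt)) *: vval (h1_vec u1) x + Mop u0 (h1_vec u1) x
      - nu *: laplacian u1 x =
    f n.+1 x + dt^-1 *: (2 *: vval (u n) x - 2^-1 *: vval (u n.-1) x)
      - grad (p n) x) ;
  barred_u1_bdry : boundary_value (h1_vec u1) (w n.+1) ;
  barred_u2 : ae_in Om (fun x =>
    (3 / (2 * dt)) *: vval (h1_vec u2) x + Mop u0 (h1_vec u2) x
      - nu *: laplacian u2 x = - nonlinear_residual x) ;
  barred_u2_bdry : boundary_value (h1_vec u2) (cst 0) ;
  barred_phi1 : is_projection phi1 (divergence (h1_vec u1)) ;
  barred_phi2 : is_projection phi2 (divergence (h1_vec u2)) ;
  barred_p1_mean : zero_mean p1 ;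
  barred_p2_mean : zero_mean p2 ;
  barred_p1 : forall q : H1 Om,
    volint Om (fun x => dotv (grad p1 x) (grad q x)) =
    volint Om (fun x => dotv
      ((3 / (2 * dt)) *: vval (h1_vec u1) x + grad (p n) x - nu *: grad phi1 x)
      (grad q x))
    - 3 / (2 * dt) * surfint Om (fun x => dotv (nv x) (w n.+1 x) * tr q x) ;
  barred_p2 : forall q : H1 Om,
    volint Om (fun x => dotv (grad p2 x) (grad q x)) =
    volint Om (fun x => dotv
      ((3 / (2 * dt)) *: vval (h1_vec u2) x - nu *: grad phi2 x)
      (grad q x)) }.

Definition ubar : 'I_d -> H2 Om := u1 + u2.

Definition ubar_three_half : 'I_d -> H1 Om :=
  (3 / 2) *: h1_vec ubar - 2^-1 *: h1_vec (ut n).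

Definition Pbar : H1 Om := (p1 + p2) + nu *: (phi1 + phi2).

Definition r_three_half : R := 3 / 2 * r n.+1 - 2^-1 * r n.

Definition xi : R := r_three_half ^+ 2 / energy C0 ubar_three_half.

Definition A1 : R :=
  volint Om (fun x => dotv (f n.+1 x) (vval (h1_vec ubar) x)).

Definition A2 : R :=
  surfint Om (fun x => dotv
    (- (tr Pbar x *: nv x) + nu *: normal_derivative nv ubar x
       - (2^-1 * dotv (nv x) (w n.+1 x)) *: w n.+1 x)
    (w n.+1 x)).

Record scheme_step : Prop := {
  step_momentum : ae_in Om (fun x =>
    dt^-1 *: ((3 / 2) *: vval (h1_vec (ut n.+1)) x - 2 *: vval (u n) x
                + 2^-1 *: vval (u n.-1) x)
    + Mop u0 (h1_vec (ut n.+1)) x + grad (p n) x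
    - nu *: laplacian (ut n.+1) x + xi *: nonlinear_residual x = f n.+1 x) ;
  step_momentum_bdry : boundary_value (h1_vec (ut n.+1)) (w n.+1) ;
  step_phi : is_projection (phi n.+1) (divergence (h1_vec (ut n.+1))) ;
  step_pressure : ae_in Om (fun x =>
    dt^-1 *: ((3 / 2) *: vval (u n.+1) x
                - (3 / 2) *: vval (h1_vec (ut n.+1)) x)
    + grad (p n.+1 - p n + nu *: phi n.+1) x = 0) ;
  step_div_free : ae_in Om (fun x => divergence (u n.+1) x = 0) ;
  step_pressure_bdry : normal_boundary_value nv (u n.+1) (w n.+1) ;
  step_pressure_mean : zero_mean (p n.+1) ;
  step_scalar :
    (3 / 2 * r n.+1 + r n - 2^-1 * r n.-1) *
      ((3 / 2 * r n.+1 - 2 * r n + 2^-1 * r n.-1) / dt) =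
    volint Om (fun x => dotv (vval (h1_vec (ut n.+1)) x)
      (dt^-1 *: ((3 / 2) *: vval (u n.+1) x - 2 *: vval (u n) x
                   + 2^-1 *: vval (u n.-1) x)))
    + xi * (- nu * volint Om (grad_sqnorm (h1_vec ubar)) + A1 + A2)
    - volint Om (fun x => dotv
        (- Mop u0 (h1_vec (ut n.+1)) x - grad (p n.+1 + nu *: phi n.+1) x
           + nu *: laplacian (ut n.+1) x - xi *: nonlinear_residual x
           + f n.+1 x)
        (vval (h1_vec (ut n.+1)) x))
    + (1 - xi) * (`|A1| + `|A2|) }.

End scheme.

(* Main.v *)
(* Adding the pressure correction to the momentum equation replaces the
   intermediate velocity by u^{n+1} in the time difference, so that the two
   volume integrals of the scalar equation are integrals of almost everywhere
   equal functions and cancel, without any integration by parts.  What remains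
   for f = 0 and w = 0 is the dissipation term, and the left-hand side of the
   scalar equation is (a - b) (a + b) / dt with a = R^{n+3/2} and
   b = R^{n+1/2}. *)
Require Import Defs.
From mathcomp Require Import all_boot all_order all_algebra.
From mathcomp Require Import all_classical all_reals all_analysis.
From mathcomp Require Import measurable_realfun ring.

Set Implicit Arguments.
Unset Strict Implicit.
Unset Printing Implicit Defensive.

Import Order.TTheory GRing.Theory Num.Theory.
Import numFieldNormedType.Exports.

Local Open Scope classical_set_scope.
Local Open Scope ring_scope.

Section integrals.
Context {R : realType} {d : nat}.
Implicit Types (Om : domain R d) (g h : 'rV[R]_d -> R).

(* Only one side needs to be measurable: Lebesgue measure is complete. *)
Lemma ae_eq_volint Om g h :
  measurable_fun (Om : set (caratheodory_type (@lebesgue_outer R d))) g ->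
  ae_in Om (fun x => g x = h x) -> volint Om g = volint Om h.
Proof.
move=> mg gh.
have Egh : ae_eq (leb d) (dset Om) (EFin \o g) (EFin \o h).
  apply: (@filterS _ _ (ae_filter_ringOfSetsType (leb d)) _ _ _ gh).
  by move=> x {}gh /gh /= ->.
have /measurable_EFinP mEg := mg.
congr fine; apply: ae_eq_integral => //; first exact: measurable_domain.
by apply: ae_measurable_fun Egh mEg; exact: measure_is_complete_caratheodory.
Qed.

Lemma volint_eq0 Om g : (forall x, dset Om x -> g x = 0) -> volint Om g = 0.
Proof.
move=> g0; rewrite /volint (@eq_Rintegral _ _ _ _ _ (cst 0)).
  by rewrite /Rintegral integral0.
by move=> x; rewrite inE => /g0.
Qed.

Lemma surfint_eq0 Om g : (forall x, bdry Om x -> g x = 0) -> surfint Om g = 0.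
Proof.
move=> g0; rewrite /surfint (@eq_Rintegral _ _ _ _ _ (cst 0)).
  by rewrite /Rintegral integral0.
by move=> x; rewrite inE => /g0.
Qed.

Lemma measurable_h1_fun Om (q : H1 Om) :
  measurable_fun (Om : set (caratheodory_type (@lebesgue_outer R d)))
    (h1_fun q).
Proof. by have /asboolP[[mq _] _ _] := h1_pairP q. Qed.

Lemma volint_grad_sqnorm_ge0 Om (v : 'I_d -> H1 Om) :
  0 <= volint Om (grad_sqnorm v).
Proof.
apply: Rintegral_ge0 => x _; apply: sumr_ge0 => i _; apply: sumr_ge0 => j _.
by rewrite -expr2 sqr_ge0.
Qed.

End integrals.

Lemma dotvC {R : realType} {d : nat} (x y : 'rV[R]_d) : dotv x y = dotv y x.
Proof. by apply: eq_bigr => i _; rewrite mulrC. Qed.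

Lemma dotv0l {R : realType} {d : nat} (y : 'rV[R]_d) : dotv 0 y = 0.
Proof. by rewrite /dotv big1// => i _; rewrite mxE mul0r. Qed.

(** Subtracting the second hypothesis from the difference quotient cancels [a] and [g]. In the
    application [c] is [dt^-1], [a] and [a'] carry the two new velocities, [b] and [e] the older
    levels, [g] and [g'] the old and new pressure gradients, and [q] is [nu] times the gradient of
    [phi n.+1]. *)
Lemma momentum_add_pressure {R : realType} {d : nat} (c xi : R)
    (a a' b e M g g' q L N F : 'rV[R]_d) :
  c *: (a - b + e) + M + g - L + xi *: N = F ->
  c *: (a' - a) + (g' - g + q) = 0 ->
  c *: (a' - b + e) = - M - (g' + q) + L - xi *: N + F.
Proof.
move=> /rowP hF /rowP h0; apply/rowP => i.
move: (hF i) (h0 i); rewrite !mxE => <- h0i.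
by rewrite -[LHS]subr0 -h0i; ring.
Qed.

Theorem theorem2p1 (R : realType) (d : nat) (hd : d = 2%N \/ d = 3%N)
  (Om : domain R d) (nv : 'rV[R]_d -> 'rV[R]_d)
  (hnv : unit_outward_normal Om nv)
  (nu dt C0 : R) (hnu : 0 < nu) (hdt : 0 < dt)
  (n : nat) (hn : (1 <= n)%N)
  (k0 m : nat) (hk0 : (1 <= k0)%N) (hm : (m * k0 <= n < m.+1 * k0)%N)
  (f w : nat -> 'rV[R]_d -> 'rV[R]_d)
  (u : nat -> 'I_d -> H1 Om) (ut : nat -> 'I_d -> H2 Om)
  (p phi : nat -> H1 Om) (r : nat -> R)
  (u1 u2 : 'I_d -> H2 Om) (phi1 phi2 p1 p2 : H1 Om)
  (hbar : barred_solution nv nu dt f w u ut p (u (m * k0)%N) n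
            u1 u2 phi1 phi2 p1 p2)
  (hE : 0 < energy C0 (ubar_three_half ut n u1 u2))
  (hscheme : scheme_step nv nu dt C0 f w u ut p phi r (u (m * k0)%N) n
               u1 u2 phi1 phi2 p1 p2)
  (hf : forall k x, dset Om x -> f k x = 0)
  (hw : forall k x, bdry Om x -> w k x = 0) :
  `|3 / 2 * r n.+1 - 2^-1 * r n| ^+ 2 - `|3 / 2 * r n - 2^-1 * r n.-1| ^+ 2 =
    - ((r_three_half r n) ^+ 2 / energy C0 (ubar_three_half ut n u1 u2)
         * nu * dt * volint Om (grad_sqnorm (h1_vec (ubar u1 u2)))) /\
  - ((r_three_half r n) ^+ 2 / energy C0 (ubar_three_half ut n u1 u2)
       * nu * dt * volint Om (grad_sqnorm (h1_vec (ubar u1 u2)))) <= 0.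
Proof.
have [hV _ _ hP _ _ _ hR] := hscheme.
set J := volint Om (grad_sqnorm _); set E := energy _ _ in hE *.
have J0 : 0 <= J by exact: volint_grad_sqnorm_ge0.
split; last first.
  (* Positivity of the energy [E] fixes the sign of the whole right-hand side. *)
  have xi0 : 0 <= r_three_half r n ^+ 2 / E by rewrite divr_ge0 ?sqr_ge0 ?ltW.
  rewrite oppr_le0.
  exact: mulr_ge0 (mulr_ge0 (mulr_ge0 xi0 (ltW hnu)) (ltW hdt)) J0.
have A10 : A1 f n u1 u2 = 0.
  by apply: volint_eq0 => x Omx; rewrite hf// dotv0l.
(* The integrand is paired with [w], so it vanishes on the boundary whatever values the traces
   take. *)
have A20 : A2 nv nu w n u1 u2 phi1 phi2 p1 p2 = 0.
  by apply: surfint_eq0 => x Omx; rewrite hw// dotvC dotv0l.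
move: hR; rewrite A10 A20 normr0 !addr0 mulr0 addr0.
set I1 := volint Om _; set I2 := volint Om (fun x => dotv (_ + f _ _) _).
have -> : I1 = I2.
  (* Measurability is checked on the side of [I1], whose integrand contains only values of $H^1$
     functions and no derivatives. *)
  apply: ae_eq_volint.
    apply: measurable_sum => i; apply: measurable_funM.
      rewrite (_ : (fun x => _) = h1_fun (h1_vec (ut n.+1) i)).
        exact: measurable_h1_fun.
      by apply/funext => x; rewrite mxE.
    under eq_fun do rewrite !mxE.
    apply: measurable_funM => //.
    by apply: measurable_funD; [apply: measurable_funB|];
      apply: measurable_funM => //; exact: measurable_h1_fun.
  apply: (@filterS2 _ _ (ae_filter_ringOfSetsType (leb d)) _ _ _ _ hV hP).
  move=> x {}hV {}hP Omx; rewrite dotvC; congr dotv.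
  (* Weak derivatives are stored in the elements of [H1], so [grad] is linear by computation at
     every point, not just almost everywhere. *)
  have gradE : grad (p n.+1 - p n + nu *: phi n.+1) x =
      grad (p n.+1) x - grad (p n) x + nu *: grad (phi n.+1) x.
    by apply/rowP => i; rewrite !mxE.
  have -> : grad (p n.+1 + nu *: phi n.+1) x =
      grad (p n.+1) x + nu *: grad (phi n.+1) x.
    by apply/rowP => i; rewrite !mxE.
  by apply: momentum_add_pressure (hV Omx) _; rewrite -gradE hP.
rewrite [I2 + _]addrC addrK /xi -/E -/J => hR.
rewrite !real_normK ?num_real//.
have /(congr1 ( *%R dt)) := hR.
rewrite mulrCA [_ / dt]mulrC mulVKf ?gt_eqF// => hR'.
(* The factors are $R^{n+3/2}+R^{n+1/2}$ and $R^{n+3/2}-R^{n+1/2}$. *)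
transitivity ((3 / 2 * r n.+1 + r n - 2^-1 * r n.-1) *
  (3 / 2 * r n.+1 - 2 * r n + 2^-1 * r n.-1)); first by field.
by rewrite hR'; ring.
Qed.
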